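(* Let $\mathbb F$ be a field of characteristic $0$, let $\mathcal A$ be a simple Artinian $\mathbb F$-algebra with center $\mathbb F$, $\mathcal A\cong M_m(D)$ with $D$ a division ring, and let $S\in\mathcal A\langle\!\langle\underline x\rangle\!\rangle$ be a recognizable series. (1) The difference in dimensions of two reduced representations of $S$ is at most $1$. (2) A representation $(\mathbf c,A,\mathbf b)$ of $S$ with obstruction modules $\mathcal U_\infty^L,\mathcal U_\infty^R$ is minimal if $\delta:=\dim_D\mathcal U_\infty^L+\dim_D\mathcal U_\infty^R<m^2$. (3) Any two totally reduced representations of $S$ are similar via a unique transition matrix.
   Context: $\underline x=\{x_1,\dots,x_g\}$ is a finite alphabet and $\langle\underline x\rangle$ is the free monoid of words in these freely noncommuting letters, with empty word $1$ and length $|w|$. $\mathcal A\langle\underline x\rangle=\mathcal A*_{\mathbb F}\mathbb F\langle\underline x\rangle$ (free product of unital $\mathbb F$-algebras) is the algebra of generalized polynomials, and $\mathcal A\langle\!\langle\underline x\rangle\!\rangle$ is its $(\underline x)$-adic completion. For $w=w_1\cdots w_\ell$, $\mathcal A^w\subset\mathcal A\langle\underline x\rangle$ is the $\mathbb F$-span of all $a_0w_1a_1\cdots w_\ell a_\ell$, $a_i\in\mathcal A$. Every series is uniquely $S=\sum_w[S,w]$ with $[S,w]\in\mathcal A^w$. A (linear) representation of dimension $n$ of $S$ is a triple $(\mathbf c,A,\mathbf b)$ with $\mathbf c\in\mathcal A^{1\times n}$, $\mathbf b\in\mathcal A^{n\times1}$ and $A^x\in(\mathcal A^x)^{n\times n}$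 for $x\in\underline x$ such that $[S,w]=\mathbf cA^w\mathbf b$ for all words $w$, where $A^w=A^{w_1}\cdots A^{w_{|w|}}$. By convention the zero series (and only it) has a representation of dimension $0$. $S$ is recognizable if it has a representation. Two representations $(\mathbf c_1,A_1,\mathbf b_1)$, $(\mathbf c_2,A_2,\mathbf b_2)$ of dimension $n$ are similar if there is an invertible $P\in\mathcal A^{n\times n}$ (a transition matrix) with $\mathbf c_2=\mathbf c_1P^{-1}$, $A_2^x=PA_1^xP^{-1}$ for all $x\in\underline x$, and $\mathbf b_2=P\mathbf b_1$. The left and right obstruction modules of $(\mathbf c,A,\mathbf b)$ are the left, respectively right, $\mathcal A$-modules $$\mathcal U_\infty^L=\{\mathbf u\in\mathcal A^{1\times n}:\mathbf uA^w\mathbf b=0\ \forall w\},\qquad \mathcal U_\infty^R=\{\mathbf v\in\mathcal A^{n\times1}:\mathbf cA^w\mathbf v=0\ \forall w\}.$$ $\dim_D$ of a left (right) $\mathcal A$-module is its dimension as a left (right) $D$-vector space via the embedding of $D$ in $M_m(D)\cong\mathcal A$ as scalar matrices. A left (right) $\mathcal A$-module $\mathcal M$ is torsion if for every $\mathbf v\in\mathcal M$ there is $a\in\mathcal A\setminus\{0\}$ with $a\mathbf v=0$ (resp. $\mathbf va=0$). A representation of $S$ is reduced if both obstruction modules are torsion; minimal if its dimension is minimal among all representations of $S$; totally reduced if both obstruction modules are trivial (zero). *)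

(* Defs.v *)
From HB Require Import structures.
From mathcomp Require Export all_boot all_order all_algebra.
From mathcomp Require Export boolp classical_sets.

Set Implicit Arguments.
Unset Strict Implicit.
Unset Printing Implicit Defensive.

Import GRing.Theory.
Local Open Scope ring_scope.
Local Open Scope quotient_scope.

Definition left_ideal (R : nzRingType) (J : set R) : Prop :=
  [/\ J 0, forall u v, J u -> J v -> J (u + v) & forall a u, J u -> J (a * u)].

Definition right_ideal (R : nzRingType) (J : set R) : Prop :=
  [/\ J 0, forall u v, J u -> J v -> J (u + v) & forall a u, J u -> J (u * a)].

Definition simple_ring (R : nzRingType) : Prop :=
  forall J : set R, left_ideal J -> right_ideal J ->
    J = [set 0]%classic \/ J = [set: R]%classic.

Definition dcc (T : Type) (P : set T -> Prop) : Prop :=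
  forall J : nat -> set T, (forall i, P (J i)) ->
    (forall i, (J i.+1 `<=` J i)%classic) ->
    exists N, forall i, (N <= i)%N -> J i = J N.

Definition artinian_ring (R : nzRingType) : Prop :=
  dcc (@left_ideal R) /\ dcc (@right_ideal R).

Definition division_ring (D : unitRingType) : Prop :=
  forall d : D, d != 0 -> d \is a GRing.unit.

Definition center_is_base (F : fieldType) (A : algType F) : Prop :=
  forall a : A, (forall b, a * b = b * a) <-> (exists k : F, a = k%:A).

(* The free product A *_F F<x_0, ..., x_{g-1}> : formal expressions in the
   elements of A and the letters, modulo the congruence generated by the axioms
   of unital F-algebras and the operations of A. *)
Section FreeProduct.

Variables (F : fieldType) (A : algType F) (g : nat).

Inductive gterm : Type :=
| TCst of A
| TVar of 'I_g
| TAdd of gterm & gterm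
| TMul of gterm & gterm.

Inductive gcongr : gterm -> gterm -> Prop :=
| gc_refl s : gcongr s s
| gc_sym s t : gcongr s t -> gcongr t s
| gc_trans s t u : gcongr s t -> gcongr t u -> gcongr s u
| gc_add s s' t t' : gcongr s s' -> gcongr t t' -> gcongr (TAdd s t) (TAdd s' t')
| gc_mul s s' t t' : gcongr s s' -> gcongr t t' -> gcongr (TMul s t) (TMul s' t')
| gc_addA s t u : gcongr (TAdd s (TAdd t u)) (TAdd (TAdd s t) u)
| gc_addC s t : gcongr (TAdd s t) (TAdd t s)
| gc_add0 s : gcongr (TAdd (TCst 0) s) s
| gc_addN s : gcongr (TAdd (TMul (TCst (- 1)) s) s) (TCst 0)
| gc_mulA s t u : gcongr (TMul s (TMul t u)) (TMul (TMul s t) u)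
| gc_mul1l s : gcongr (TMul (TCst 1) s) s
| gc_mul1r s : gcongr (TMul s (TCst 1)) s
| gc_mulDl s t u : gcongr (TMul (TAdd s t) u) (TAdd (TMul s u) (TMul t u))
| gc_mulDr s t u : gcongr (TMul s (TAdd t u)) (TAdd (TMul s t) (TMul s u))
| gc_cstD a b : gcongr (TCst (a + b)) (TAdd (TCst a) (TCst b))
| gc_cstM a b : gcongr (TCst (a * b)) (TMul (TCst a) (TCst b))
| gc_scal (k : F) s : gcongr (TMul (TCst k%:A) s) (TMul s (TCst k%:A)).

HB.instance Definition _ := gen_eqMixin gterm.
HB.instance Definition _ := gen_choiceMixin gterm.

Definition gcongrb : rel gterm := fun s t => `[< gcongr s t >].

Lemma gcongrb_equiv : equiv_class_of gcongrb.
Proof.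
split=> [s|s t|t s u].
- by apply/asboolP; apply: gc_refl.
- by apply/asboolP/asboolP; apply: gc_sym.
- by move=> /asboolP st /asboolP tu; apply/asboolP; apply: gc_trans tu.
Qed.

Canonical gcongr_equiv := EquivRelPack gcongrb_equiv.

Definition gpoly : Type := {eq_quot gcongrb}.

HB.instance Definition _ := Choice.on gpoly.
HB.instance Definition _ := EqQuotient.on gpoly.

Definition gpi (t : gterm) : gpoly := \pi_gpoly t.

Lemma gpiE s t : gpi s = gpi t <-> gcongr s t.
Proof.
split=> [/eqP|st].
  by rewrite /gpi eqmodE => /asboolP.
by apply/eqP; rewrite /gpi eqmodE; apply/asboolP.
Qed.

Lemma gpi_repr p : gpi (repr p) = p.
Proof. exact: reprK. Qed.

Lemma gpi_ind (P : gpoly -> Prop) : (forall t, P (gpi t)) -> forall p, P p.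
Proof. by move=> h p; rewrite -(gpi_repr p). Qed.

Definition gp_cst (a : A) : gpoly := gpi (TCst a).
Definition gp_var (i : 'I_g) : gpoly := gpi (TVar i).
Definition gp_add (p q : gpoly) : gpoly := gpi (TAdd (repr p) (repr q)).
Definition gp_mul (p q : gpoly) : gpoly := gpi (TMul (repr p) (repr q)).
Definition gp_opp (p : gpoly) : gpoly := gp_mul (gp_cst (- 1)) p.

Lemma gp_addE s t : gp_add (gpi s) (gpi t) = gpi (TAdd s t).
Proof. by apply/gpiE; apply: gc_add; apply/gpiE; rewrite gpi_repr. Qed.

Lemma gp_mulE s t : gp_mul (gpi s) (gpi t) = gpi (TMul s t).
Proof. by apply/gpiE; apply: gc_mul; apply/gpiE; rewrite gpi_repr. Qed.

Let gpE := (gp_addE, gp_mulE).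

Fact gp_addA : associative gp_add.
Proof.
by elim/gpi_ind=> s; elim/gpi_ind=> t; elim/gpi_ind=> u; rewrite !gpE;
  apply/gpiE; constructor.
Qed.

Fact gp_addC : commutative gp_add.
Proof.
by elim/gpi_ind=> s; elim/gpi_ind=> t; rewrite !gpE; apply/gpiE; apply: gc_addC.
Qed.

Fact gp_add0 : left_id (gp_cst 0) gp_add.
Proof. by elim/gpi_ind=> s; rewrite !gpE; apply/gpiE; apply: gc_add0. Qed.

Fact gp_addN : left_inverse (gp_cst 0) gp_opp gp_add.
Proof.
by elim/gpi_ind=> s; rewrite /gp_opp gp_mulE gp_addE; apply/gpiE; apply: gc_addN.
Qed.

HB.instance Definition _ :=
  GRing.isZmodule.Build gpoly gp_addA gp_addC gp_add0 gp_addN.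

Fact gp_mulA : associative gp_mul.
Proof.
by elim/gpi_ind=> s; elim/gpi_ind=> t; elim/gpi_ind=> u; rewrite !gpE;
  apply/gpiE; apply: gc_mulA.
Qed.

Fact gp_mul1l : left_id (gp_cst 1) gp_mul.
Proof. by elim/gpi_ind=> s; rewrite !gpE; apply/gpiE; apply: gc_mul1l. Qed.

Fact gp_mul1r : right_id (gp_cst 1) gp_mul.
Proof. by elim/gpi_ind=> s; rewrite !gpE; apply/gpiE; apply: gc_mul1r. Qed.

Fact gp_mulDl : left_distributive gp_mul +%R.
Proof.
elim/gpi_ind=> s; elim/gpi_ind=> t; elim/gpi_ind=> u.
rewrite /GRing.add /= (gp_addE s t) (gp_mulE s u) (gp_mulE t u) gp_mulE gp_addE.
by apply/gpiE; apply: gc_mulDl.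
Qed.

Fact gp_mulDr : right_distributive gp_mul +%R.
Proof.
elim/gpi_ind=> s; elim/gpi_ind=> t; elim/gpi_ind=> u.
rewrite /GRing.add /= (gp_addE t u) (gp_mulE s t) (gp_mulE s u) gp_mulE gp_addE.
by apply/gpiE; apply: gc_mulDr.
Qed.

Section Eval.
Variables (B : algType F) (f : {lrmorphism A -> B}) (v : 'I_g -> B).

Fixpoint geval (t : gterm) : B :=
  match t with
  | TCst a => f a
  | TVar i => v i
  | TAdd s u => geval s + geval u
  | TMul s u => geval s * geval u
  end.

Lemma geval_congr s t : gcongr s t -> geval s = geval t.
Proof.
elim=> //= {s t}; try congruence.
- by move=> s t u; rewrite addrA.
- by move=> s t; rewrite addrC.
- by move=> s; rewrite rmorph0 add0r.
- by move=> s; rewrite rmorphN rmorph1 mulN1r addNr rmorph0.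
- by move=> s t u; rewrite mulrA.
- by move=> s; rewrite rmorph1 mul1r.
- by move=> s; rewrite rmorph1 mulr1.
- by move=> s t u; rewrite mulrDl.
- by move=> s t u; rewrite mulrDr.
- by move=> a b; rewrite rmorphD.
- by move=> a b; rewrite rmorphM.
- by move=> k s; rewrite linearZ /= rmorph1 mulr_algl mulr_algr.
Qed.

End Eval.

Fact gp_1neq0 : gp_cst 1 != 0.
Proof.
apply/eqP => /gpiE /(geval_congr idfun (fun _ => 0)) /= /eqP.
by rewrite oner_eq0.
Qed.

HB.instance Definition _ := GRing.Zmodule_isNzRing.Build gpoly
  gp_mulA gp_mul1l gp_mul1r gp_mulDl gp_mulDr gp_1neq0.

Fact gp_cst_is_zmod_morphism : zmod_morphism gp_cst.
Proof.
have cD a b : gp_cst (a + b) = gp_cst a + gp_cst b.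
  by rewrite /GRing.add /= !gpE; apply/gpiE; apply: gc_cstD.
move=> a b; apply: (addIr (gp_cst b)); rewrite -cD.
by rewrite !subrK.
Qed.

HB.instance Definition _ :=
  GRing.isZmodMorphism.Build A gpoly gp_cst gp_cst_is_zmod_morphism.

Fact gp_cst_is_monoid_morphism : monoid_morphism gp_cst.
Proof.
by split=> // a b; rewrite /GRing.mul /= !gpE; apply/gpiE; apply: gc_cstM.
Qed.

HB.instance Definition _ :=
  GRing.isMonoidMorphism.Build A gpoly gp_cst gp_cst_is_monoid_morphism.

Definition gp_scale (k : F) (p : gpoly) : gpoly := gp_cst k%:A * p.

Fact gp_scaleA a b v : gp_scale a (gp_scale b v) = gp_scale (a * b) v.
Proof. by rewrite /gp_scale mulrA -rmorphM /= mulr_algl scalerA. Qed.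

Fact gp_scale1 : left_id 1 gp_scale.
Proof. by move=> p; rewrite /gp_scale scale1r rmorph1 mul1r. Qed.

Fact gp_scaleDr : right_distributive gp_scale +%R.
Proof. by move=> k p q; rewrite /gp_scale mulrDr. Qed.

Fact gp_scaleDl v : {morph gp_scale^~ v : a b / a + b}.
Proof. by move=> a b; rewrite /gp_scale scalerDl rmorphD mulrDl. Qed.

HB.instance Definition _ := GRing.Zmodule_isLmodule.Build F gpoly
  gp_scaleA gp_scale1 gp_scaleDr gp_scaleDl.

Fact gp_scaleAl (k : F) (p q : gpoly) : k *: (p * q) = k *: p * q.
Proof. by rewrite /GRing.scale /= /gp_scale mulrA. Qed.

HB.instance Definition _ := GRing.Lmodule_isLalgebra.Build F gpoly gp_scaleAl.

Fact gp_cst_central (k : F) (p : gpoly) : gp_cst k%:A * p = p * gp_cst k%:A.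
Proof.
elim/gpi_ind: p => s; rewrite /GRing.mul /= !gpE; apply/gpiE; apply: gc_scal.
Qed.

Fact gp_scaleAr (k : F) (p q : gpoly) : k *: (p * q) = p * (k *: q).
Proof.
by rewrite /GRing.scale /= /gp_scale mulrA gp_cst_central mulrA.
Qed.

HB.instance Definition _ := GRing.Lalgebra_isAlgebra.Build F gpoly gp_scaleAr.

Fact gp_cst_is_scalable : scalable gp_cst.
Proof.
by move=> k a; rewrite {2}/GRing.scale /= /gp_scale -rmorphM /= mulr_algl.
Qed.

HB.instance Definition _ :=
  GRing.isScalable.Build F A gpoly *:%R gp_cst gp_cst_is_scalable.

End FreeProduct.

Arguments gp_cst {F A} g a.
Arguments gp_var {F} A {g} i.

(* gpoly A g is the coproduct of A and the free algebra on g letters. *)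
Section UniversalProperty.

Variables (F : fieldType) (A : algType F) (g : nat).
Variables (B : algType F) (f : {lrmorphism A -> B}) (v : 'I_g -> B).

Definition gp_eval (p : gpoly A g) : B := geval f v (repr p).

Lemma gp_evalE t : gp_eval (gpi t) = geval f v t.
Proof. by apply: geval_congr; apply/gpiE; rewrite gpi_repr. Qed.

Fact gp_evalD : {morph gp_eval : p q / p + q}.
Proof.
elim/gpi_ind=> s; elim/gpi_ind=> t.
by rewrite {1}/GRing.add /= gp_addE !gp_evalE.
Qed.

Fact gp_eval_is_zmod_morphism : zmod_morphism gp_eval.
Proof.
by move=> p q; apply: (addIr (gp_eval q)); rewrite -gp_evalD !subrK.
Qed.

HB.instance Definition _ :=
  GRing.isZmodMorphism.Build (gpoly A g) B gp_eval gp_eval_is_zmod_morphism.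

Lemma gp_eval_cst a : gp_eval (gp_cst g a) = f a.
Proof. by rewrite gp_evalE. Qed.

Lemma gp_eval_var i : gp_eval (gp_var A i) = v i.
Proof. by rewrite gp_evalE. Qed.

Fact gp_eval_is_monoid_morphism : monoid_morphism gp_eval.
Proof.
split=> [|]; first by rewrite gp_eval_cst rmorph1.
elim/gpi_ind=> s; elim/gpi_ind=> t.
by rewrite {1}/GRing.mul /= gp_mulE !gp_evalE.
Qed.

HB.instance Definition _ :=
  GRing.isMonoidMorphism.Build (gpoly A g) B gp_eval gp_eval_is_monoid_morphism.

Fact gp_eval_is_scalable : scalable gp_eval.
Proof.
move=> k p; rewrite {1}/GRing.scale /= /gp_scale rmorphM /= gp_eval_cst.
by rewrite linearZ /= rmorph1 mulr_algl.
Qed.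

HB.instance Definition _ :=
  GRing.isScalable.Build F (gpoly A g) B *:%R gp_eval gp_eval_is_scalable.

Lemma gpoly_universal :
  exists h : {lrmorphism gpoly A g -> B},
    [/\ forall a, h (gp_cst g a) = f a,
        forall i, h (gp_var A i) = v i
      & forall h' : {lrmorphism gpoly A g -> B},
          (forall a, h' (gp_cst g a) = f a) ->
          (forall i, h' (gp_var A i) = v i) -> h' =1 h].
Proof.
exists gp_eval; split; [exact: gp_eval_cst|exact: gp_eval_var|].
move=> h' hc hv; elim/gpi_ind; elim=> [a|i|s IHs t IHt|s IHs t IHt].
- by rewrite hc -gp_eval_cst.
- by rewrite hv -gp_eval_var.
- by rewrite -gp_addE [gp_add _ _]/(_ + _ : gpoly A g) !raddfD /= IHs IHt.
- by rewrite -gp_mulE [gp_mul _ _]/(_ * _ : gpoly A g) !rmorphM /= IHs IHt.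
Qed.

End UniversalProperty.

Section Series.

Variables (F : fieldType) (A : algType F) (g : nat).

Local Notation AX := (gpoly A g).
Local Notation letter := 'I_g.
Local Notation word := (seq 'I_g).

(* The monomial a_0 w_1 a_1 ... w_l a_l, where w = w_1 ... w_l and
   a_i = a i; the values of a beyond l = size w are not used. *)
Fixpoint gmonomial (w : word) (a : nat -> A) : AX :=
  match w with
  | [::] => gp_cst g (a 0%N)
  | x :: w' => gp_cst g (a 0%N) * gp_var A x * gmonomial w' (fun i => a i.+1)
  end.

(* The subspace A^w of A<x>. *)
Definition homog (w : word) : set AX :=
  [set p | exists s : seq (F * (nat -> A)),
     p = \sum_(t <- s) t.1 *: gmonomial w t.2]%classic.

(* A series S = sum_w [S,w] is given by its components [S,w] in A^w; over a
   finite alphabet these are exactly the elements of the (x)-adic completion. *)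
Record gseries := GSeries {
  component :> word -> AX;
  componentP : forall w, homog w (component w) }.

Record repr_data (n : nat) := ReprData {
  rc : 'rV[A]_n;
  rA : letter -> 'M[AX]_n;
  rb : 'cV[A]_n;
  rA_lin : forall x i j, homog [:: x] (rA x i j) }.

Definition word_mx n (r : repr_data n) (w : word) : 'M[AX]_n :=
  \prod_(x <- w) rA r x.

Definition represents n (r : repr_data n) (S : gseries) : Prop :=
  forall w, map_mx (gp_cst g) (rc r) *m word_mx r w *m map_mx (gp_cst g) (rb r)
            = (S w)%:M.

Lemma represents_dim0 (r : repr_data 0) (S : gseries) :
  represents r S <-> forall w, S w = 0.
Proof.
have E w : map_mx (gp_cst g) (rc r) *m word_mx r w *m map_mx (gp_cst g) (rb r)
           = 0 :> 'M_1 by rewrite thinmx0 !mul0mx.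
split=> h w; last by rewrite E h raddf0.
by have /matrixP/(_ 0 0) := h w; rewrite E !mxE eqxx mulr1n.
Qed.

Definition recognizable (S : gseries) : Prop :=
  exists n (r : repr_data n), represents r S.

Definition left_obstruction n (r : repr_data n) : set 'rV[A]_n :=
  [set u | forall w,
     map_mx (gp_cst g) u *m word_mx r w *m map_mx (gp_cst g) (rb r) = 0]%classic.

Definition right_obstruction n (r : repr_data n) : set 'cV[A]_n :=
  [set v | forall w,
     map_mx (gp_cst g) (rc r) *m word_mx r w *m map_mx (gp_cst g) v = 0]%classic.

(* For a column v, the product v *m a%:M is v with a acting on the right of
   every entry, while a *: u acts on the left. *)
Definition left_torsion n (U : set 'rV[A]_n) : Prop :=
  forall u, U u -> exists2 a : A, a != 0 & a *: u = 0.

Definition right_torsion n (V : set 'cV[A]_n) : Prop :=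
  forall v, V v -> exists2 a : A, a != 0 & v *m a%:M = 0.

Definition reduced n (r : repr_data n) : Prop :=
  left_torsion (left_obstruction r) /\ right_torsion (right_obstruction r).

Definition totally_reduced n (r : repr_data n) : Prop :=
  left_obstruction r = [set 0]%classic /\ right_obstruction r = [set 0]%classic.

Definition minimal n (r : repr_data n) (S : gseries) : Prop :=
  represents r S /\
  forall n' (r' : repr_data n'), represents r' S -> (n <= n')%N.

Definition transition n (r1 r2 : repr_data n) (P : 'M[A]_n) : Prop :=
  exists Q : 'M[A]_n,
    [/\ P *m Q = 1%:M, Q *m P = 1%:M, rc r2 = rc r1 *m Q,
        forall x, rA r2 x =
          map_mx (gp_cst g) P *m rA r1 x *m map_mx (gp_cst g) Q
      & rb r2 = P *m rb r1].

Definition cast_repr n1 n2 (e : n1 = n2) (r : repr_data n1) : repr_data n2 :=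
  ecast n (repr_data n) e r.

End Series.

(* U is a k-dimensional D-subspace of V, for the scalar action act. *)
Definition has_dim (D : nzRingType) (V : zmodType) (act : D -> V -> V)
    (U : set V) (k : nat) : Prop :=
  exists v : 'I_k -> V,
    [/\ forall i, U (v i),
        forall d : 'I_k -> D, \sum_(i < k) act (d i) (v i) = 0 ->
          forall i, d i = 0
      & forall u, U u -> exists d : 'I_k -> D, u = \sum_(i < k) act (d i) (v i)].

(* D acts on rows and columns over A through the scalar matrices of
   'M[D]_m and a ring isomorphism phi from 'M[D]_m to A. *)
Definition left_dim (D A : nzRingType) (m : nat)
    (phi : {rmorphism 'M[D]_m -> A}) n (U : set 'rV[A]_n) (k : nat) : Prop :=
  has_dim (fun (d : D) (u : 'rV[A]_n) => phi d%:M *: u) U k.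

Definition right_dim (D A : nzRingType) (m : nat)
    (phi : {rmorphism 'M[D]_m -> A}) n (V : set 'cV[A]_n) (k : nat) : Prop :=
  has_dim (fun (d : D) (v : 'cV[A]_n) => v *m (phi d%:M)%:M) V k.

(* Main.v *)
From HB Require Import structures.
Require Import Defs.
From mathcomp Require Import all_boot all_order all_algebra.
From mathcomp Require Import boolp classical_sets.

Set Implicit Arguments.
Unset Strict Implicit.
Unset Printing Implicit Defensive.

Import GRing.Theory.
Local Open Scope ring_scope.

(** Two representations r1 = (c1, A1, b1) and r2 = (c2, A2, b2) of the same
    series are compared through the left A-linear relation K on rows that
    relates u and v when u A1^w b1 = v A2^w b2 for every word w
    ([same_output]).  Since both represent S, K relates c1 to c2.  Moreover K is
    stable under replacing every letter by an arbitrary element of A: if K u v,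
    then K (u A1^x(y)) (v A2^x(y)) for all y in A ([same_output_subst]).

    The rows related to 0 form the left obstruction module U of r1, and a column
    v killed by the domain of K lies in the right obstruction module V of r1:
    all the evaluations of c1 A1^w v at elements of A vanish by stability of K,
    and this forces c1 A1^w v = 0 ([annihilator_right_obstruction]).  Because
    the domain of K has A-length at most length(U) + n2 m, while this length and
    that of the annihilator of the domain add up to n1 m, we get the inequality
       n1 m <= n2 m + length(U) + length(V),
    the heart of the proof ([obstruction_rank]).  Here A = M_m(D), and lengths
    are read off as numbers of rows over D: a submodule of A^(1 x n) consists of
    the m x nm matrices over D whose rows lie in a fixed subspace of D^(nm), so
    that its D-dimension is m times its length ([linear_rel_rank]).

    The three claims follow.  A torsion submodule contains no copy of A, hence
    has length at most m - 1; so n1 m <= n2 m + 2 (m - 1) if r1 is reduced, and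
    n1 <= n2 + 1.  If the D-dimensions of U and V add up to less than m^2, then
    length(U) + length(V) < m and n1 <= n2.  If r1 and r2 are totally reduced,
    then n1 = n2 and K is the graph of a bijection u |-> u Q; the inverse of Q
    is a transition matrix.  Any transition matrix arises in this way from K,
    hence there is only one.

    The passage between letters and elements of A rests on one fact about
    A<x>: an element sum_k a_k x p_k is zero if and only if sum_k a_k y p_k = 0
    for all y in A.  One direction is given by the derivation-like map
    [fox x y] that sends a x p to a y p; the other one ([generic_identity]) is
    where simplicity and centrality of A enter. *)

(** * Linear algebra over a division ring *)

Section DivisionRing.

Variables (D : unitRingType) (divD : division_ring D).

(** Gaussian elimination: a nonzero pivot in the first column clears that
    column at the cost of one row, which keeps the matrix tall. *)
Lemma tall_left_kernel p q (M : 'M[D]_(q, p)) :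
  (p < q)%N -> exists2 u : 'rV[D]_q, u != 0 & u *m M = 0.
Proof.
elim: p q M => [|p IHp] [|q] M //= ltpq.
  exists (delta_mx 0 0); last by rewrite [M]thinmx0 mulmx0.
  by apply/eqP => /rowP/(_ 0) /eqP; rewrite !mxE !eqxx oner_eq0.
(* A zero first column can be ignored; otherwise row i0 is the pivot. *)
have [[i0 Mi0]|col0] := pselect (exists i, M i 0 != 0); last first.
  have [u nz_u uM] := IHp _ (col' 0 M) (ltnW ltpq).
  exists u => //; apply/rowP => j.
  case: (unliftP 0 j) => [j' ->|->].
    by have /rowP/(_ j') := uM; rewrite !mxE => eq0; rewrite -[RHS]eq0;
      apply: eq_bigr => k _; rewrite !mxE.
  rewrite !mxE big1 // => k _.
  have -> : M k 0 = 0 by apply/eqP; apply: contra_notT col0 => Mk; exists k.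
  by rewrite mulr0.
have unitM := divD Mi0.
pose t k := - (M (lift i0 k) 0 / M i0 0).
pose M' : 'M[D]_(q, p) :=
  \matrix_(k, j) (M (lift i0 k) (lift 0 j) + t k * M i0 (lift 0 j)).
have [v nz_v vM'] := IHp _ M' ltpq.
pose u : 'rV[D]_q.+1 :=
  \row_k (if unlift i0 k is Some k' then v 0 k' else \sum_k' v 0 k' * t k').
have uM j : (u *m M) 0 j = \sum_k v 0 k * (M (lift i0 k) j + t k * M i0 j).
  rewrite mxE (bigD1_ord i0) //= !mxE unlift_none mulr_suml -big_split /=.
  apply: eq_bigr => k _; rewrite !mxE liftK mulrDr mulrA; exact: addrC.
exists u.
  apply: contra_neq nz_v => u0; apply/rowP => k.
  by have /rowP/(_ (lift i0 k)) := u0; rewrite !mxE liftK.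
apply/rowP => j; rewrite uM mxE; case: (unliftP 0 j) => [j' ->|->].
  by have /rowP/(_ j') := vM'; rewrite !mxE => eq0; rewrite -[RHS]eq0;
      apply: eq_bigr => k _; rewrite !mxE.
by rewrite big1 // => k _; rewrite /t mulNr divrK // subrr mulr0.
Qed.

Lemma mulmx1_leq p q (Z : 'M[D]_(q, p)) (T : 'M[D]_(p, q)) :
  Z *m T = 1%:M -> (q <= p)%N.
Proof.
move=> ZT; rewrite leqNgt; apply/negP => /(tall_left_kernel Z)[u /negP nz_u uZ].
by apply: nz_u; rewrite -[u]mulmx1 -ZT mulmxA uZ mul0mx.
Qed.

Definition subspace N (R : 'rV[D]_N -> Prop) : Prop :=
  [/\ R 0, forall u v, R u -> R v -> R (u + v) & forall d u, R u -> R (d *: u)].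

Lemma subspace_mulmx N (R : 'rV[D]_N -> Prop) r (B : 'M[D]_(r, N)) u :
  subspace R -> (forall k, R (row k B)) -> R (u *m B).
Proof.
move=> [R0 RD RZ] RB; rewrite mulmx_sum_row.
by elim/big_rec: _ => // k v _ Rv; apply: RD => //; apply: RZ.
Qed.

(** The basis B comes with a dual family of columns C, so that C B is a
    projection onto R and u C are the coordinates of u.  It is obtained as a
    pair (B, C) with B C = 1 and rows in R of maximal size: the size is bounded
    by [mulmx1_leq], and a vector v of R outside the row space of B may be
    corrected so that v C = 0, after which it extends the pair. *)
Lemma split_basis N (R : 'rV[D]_N -> Prop) : subspace R ->
  exists r (B : 'M[D]_(r, N)) (C : 'M[D]_(N, r)),
    [/\ B *m C = 1%:M, forall k, R (row k B)
      & forall u, R u -> u = u *m C *m B].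
Proof.
move=> subR; have [R0 RD RZ] := subR.
pose P r := `[< exists (B : 'M[D]_(r, N)) (C : 'M[D]_(N, r)),
                B *m C = 1%:M /\ forall k, R (row k B) >].
have exP : exists r, P r.
  exists 0%N; apply/asboolP; exists 0, 0; split; last by case=> [].
  by apply/matrixP; case=> [].
have ubP r : P r -> (r <= N)%N by move=> /asboolP[B [C [/mulmx1_leq]]].
case: (ex_maxnP exP ubP) => r /asboolP[B [C [BC RB]]] max_r.
exists r, B, C; split=> // u Ru; apply: contrapT => /eqP nz_u.
pose v := u - u *m C *m B.
have Rv : R v.
  apply: RD => //; rewrite -scaleN1r; apply: RZ; exact: subspace_mulmx.
have vC : v *m C = 0 by rewrite mulmxBl -[X in _ - X]mulmxA BC mulmx1 subrr.
have nz_v : v <> 0 by move/subr0_eq => vE; case/eqP: nz_u.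
clearbody v; clear nz_u.
have [j nz_vj] : exists j, v 0 j != 0.
  apply: contrapT => v0; apply: nz_v; apply/rowP => j; rewrite mxE.
  by apply: contrapT => /eqP vj; apply: v0; exists j.
pose v1 := (v 0 j)^-1 *: v.
have v1C : v1 *m C = 0 by rewrite -scalemxAl vC scaler0.
have v1j : v1 *m delta_mx j (0 : 'I_1) = 1%:M.
  by apply/rowP => i; rewrite -colE !mxE !ord1 eqxx (mulVr (divD nz_vj)).
(* The coordinate j of v1 is 1; subtracting C B makes the new column c
   orthogonal to B, and it still pairs to 1 with v1 because v1 C = 0. *)
pose c := (1%:M - C *m B) *m delta_mx j (0 : 'I_1).
suff /max_r : P (r + 1)%N by rewrite addn1 ltnn.
apply/asboolP; exists (col_mx B v1), (row_mx C c); split.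
  rewrite mul_col_row BC v1C /c !mulmxA !mulmxBr !mulmx1 !mulmxA BC mul1mx.
  by rewrite subrr mul0mx v1C mul0mx subr0 v1j -scalar_mx_block.
move=> k; rewrite -[k]splitK; case: (split k) => k' /=.
  by rewrite rowKu.
by rewrite rowKd row_id; apply: RZ.
Qed.

(** The rank-nullity theorem for a linear relation K from D^N to D^N': the
    dimension of its domain is at most N' plus the dimension k of the space of
    vectors related to 0.  The codimension l of the domain is witnessed by
    linear equations C2, independent because of their left inverse B2. *)
Lemma relation_rank N N' (K : 'rV[D]_N -> 'rV[D]_N' -> Prop) :
  K 0 0 -> (forall u u' v v', K u u' -> K v v' -> K (u + v) (u' + v')) ->
  (forall d u u', K u u' -> K (d *: u) (d *: u')) ->
  exists k (B : 'M[D]_(k, N)) (C : 'M[D]_(N, k)),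
  exists l (B2 : 'M[D]_(l, N)) (C2 : 'M[D]_(N, l)),
    [/\ B *m C = 1%:M, forall i, K (row i B) 0, B2 *m C2 = 1%:M,
        forall u, u *m C2 = 0 <-> exists u', K u u'
      & (N <= N' + k + l)%N].
Proof.
move=> K0 KD KZ.
have sub_ker : subspace (fun u => K u 0).
  split=> // [u v Ku Kv|d u Ku]; first by rewrite -[0]addr0; apply: KD.
  by rewrite -[0](scaler0 _ d); apply: KZ.
have sub_dom : subspace (fun u => exists u', K u u').
  split; first by exists 0.
    by move=> u v [u' Ku] [v' Kv]; exists (u' + v'); apply: KD.
  by move=> d u [u' Ku]; exists (d *: u'); apply: KZ.
have [k [B0 [C0 [BC0 KB0 ker_eq]]]] := split_basis sub_ker.
have [r [B [C [BC /choice[b Kb] dom_eq]]]] := split_basis sub_dom.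
have sub_C : subspace (fun u => u *m C = 0).
  split=> [|u v uC vC|d u uC]; first by rewrite mul0mx.
    by rewrite mulmxDl uC vC addr0.
  by rewrite -scalemxAl uC scaler0.
have [l [B2 [C2' [BC2 KB2 cpl_eq]]]] := split_basis sub_C.
(* M projects along the domain; correcting C2' by M makes the equations
   vanish on the domain. *)
pose M := 1%:M - C *m B; pose C2 := M *m C2'.
have MC : M *m C = 0 by rewrite mulmxBl mul1mx -mulmxA BC mulmx1 subrr.
have B2C : B2 *m C = 0 by apply/row_matrixP => i; rewrite row_mul KB2 row0.
have ME : M = C2 *m B2.
  apply/row_matrixP => i; rewrite /C2 2!row_mul.
  by apply: cpl_eq; rewrite -row_mul MC row0.
pose B' : 'M[D]_(r, N') := \matrix_i b i.
have Kxb (x : 'rV[D]_r) : K (x *m B) (x *m B').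
  rewrite !mulmx_sum_row; elim/big_rec2: _ => // i u u' _ Ku.
  by apply: KD => //; apply: KZ; rewrite rowK.
exists k, B0, C0, l, B2, C2; split=> //.
- by rewrite mulmxA mulmxBr mulmx1 mulmxA B2C mul0mx subr0.
- move=> u; split=> [uC2|/dom_eq uE].
    have uE : u = u *m C *m B.
      have /(congr1 (mulmx u)) := ME.
      rewrite [in RHS]mulmxA uC2 mul0mx mulmxBr mulmx1 mulmxA.
      by move/eqP; rewrite subr_eq0 => /eqP.
    by rewrite uE; exists (u *m C *m B').
  by rewrite mulmxA mulmxBr mulmx1 mulmxA -uE subrr mul0mx.
have leNrl : (N <= r + l)%N.
  apply: (@mulmx1_leq _ _ (row_mx C C2) (col_mx B B2)).
  by rewrite mul_row_col -ME addrC subrK.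
suff lerNk : (r <= N' + k)%N by apply: leq_trans leNrl _; rewrite leq_add2r.
(* If r > N' + k, some combination x B of basis vectors of the domain is
   related to 0 and has zero coordinates in the space of such vectors. *)
rewrite leqNgt; apply/negP => /(tall_left_kernel (row_mx B' (B *m C0))).
move=> [x /negP nz_x].
rewrite mul_mx_row -row_mx0 => /eq_row_mx[xB' xBC].
apply: nz_x; rewrite -[x]mulmx1 -BC mulmxA [x *m B]ker_eq.
  by rewrite -[x *m B *m C0]mulmxA xBC !mul0mx.
by rewrite -xB'.
Qed.

End DivisionRing.

(** * Rows over A as matrices over D *)

Section Morita.

Variables (F : fieldType) (A : algType F) (D : unitRingType) (m : nat).
Variables (phi : {rmorphism 'M[D]_m -> A}) (psi : A -> 'M[D]_m).
Hypotheses (phiK : cancel phi psi) (psiK : cancel psi phi).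

(* A row over A of length n is an m x nm matrix over D; its columns are indexed
   by pairs so that no index arithmetic is needed. *)
Local Notation N n := #|{: 'I_n * 'I_m}|.

Definition flat n (u : 'rV[A]_n) : 'M[D]_(m, N n) :=
  \matrix_(i, l) psi (u 0 (enum_val l).1) i (enum_val l).2.

Definition unflat n (M : 'M[D]_(m, N n)) : 'rV[A]_n :=
  \row_j phi (\matrix_(i, k) M i (enum_rank (j, k))).

Definition cflat n (v : 'cV[A]_n) : 'M[D]_(N n, m) :=
  \matrix_(l, i) psi (v (enum_val l).1 0) (enum_val l).2 i.

Definition cunflat n (M : 'M[D]_(N n, m)) : 'cV[A]_n :=
  \col_j phi (\matrix_(k, i) M (enum_rank (j, k)) i).

Lemma flatK n : cancel (@flat n) (@unflat n).
Proof.
move=> u; apply/rowP => j; rewrite mxE -[RHS]psiK; congr (phi _).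
by apply/matrixP => i k; rewrite !mxE enum_rankK.
Qed.

Lemma unflatK n : cancel (@unflat n) (@flat n).
Proof.
move=> M; apply/matrixP => i l.
by rewrite !mxE phiK mxE -surjective_pairing enum_valK.
Qed.

Lemma cflatK n : cancel (@cflat n) (@cunflat n).
Proof.
move=> u; apply/colP => j; rewrite mxE -[RHS]psiK; congr (phi _).
by apply/matrixP => i k; rewrite !mxE enum_rankK.
Qed.

Lemma cunflatK n : cancel (@cunflat n) (@cflat n).
Proof.
move=> M; apply/matrixP => l i.
by rewrite !mxE phiK mxE -surjective_pairing enum_valK.
Qed.

Lemma unflat0 n : unflat (0 : 'M_(m, N n)) = 0.
Proof.
apply/rowP => j; rewrite !mxE -[RHS](rmorph0 phi); congr (phi _).
by apply/matrixP => i k; rewrite !mxE.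
Qed.

Lemma unflatD n (M M' : 'M_(m, N n)) : unflat (M + M') = unflat M + unflat M'.
Proof.
apply/rowP => j; rewrite !mxE -rmorphD; congr (phi _).
by apply/matrixP => i k; rewrite !mxE.
Qed.

Lemma unflatZ n X (M : 'M_(m, N n)) : unflat (X *m M) = phi X *: unflat M.
Proof.
apply/rowP => j; rewrite !mxE -rmorphM; congr (phi _).
by apply/matrixP => i k; rewrite !mxE; apply: eq_bigr => l _; rewrite mxE.
Qed.

Lemma cunflat0 n : cunflat (0 : 'M_(N n, m)) = 0.
Proof.
apply/colP => j; rewrite !mxE -[RHS](rmorph0 phi); congr (phi _).
by apply/matrixP => i k; rewrite !mxE.
Qed.

Lemma cunflatD n (M M' : 'M_(N n, m)) :
  cunflat (M + M') = cunflat M + cunflat M'.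
Proof.
apply/colP => j; rewrite !mxE -rmorphD; congr (phi _).
by apply/matrixP => i k; rewrite !mxE.
Qed.

Lemma cunflatZ n X (M : 'M_(N n, m)) :
  cunflat (M *m X) = cunflat M *m (phi X)%:M.
Proof.
apply/colP => j; rewrite !mxE big_ord1 !mxE eqxx mulr1n -rmorphM.
congr (phi _); apply/matrixP => i k; rewrite !mxE.
by apply: eq_bigr => l _; rewrite mxE.
Qed.

Lemma mul_unflat n (M : 'M_(m, N n)) W :
  unflat M *m cunflat W = (phi (M *m W))%:M.
Proof.
apply/matrixP => i j; rewrite !ord1 !mxE eqxx mulr1n.
under eq_bigr => k _ do rewrite !mxE -rmorphM.
rewrite -rmorph_sum; congr (phi _); apply/matrixP => i' j'.
rewrite summxE mxE (reindex enum_rank); last first.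
  by apply: onW_bij; apply: enum_rank_bij.
transitivity (\sum_k \sum_l M i' (enum_rank (k, l)) * W (enum_rank (k, l)) j').
  by apply: eq_bigr => k _; rewrite mxE; apply: eq_bigr => l _; rewrite !mxE.
by rewrite pair_bigA; apply: eq_bigr => -[].
Qed.

Definition linear_rel n n' (K : 'rV[A]_n -> 'rV[A]_n' -> Prop) : Prop :=
  [/\ K 0 0,
      forall u u' v v', K u u' -> K v v' -> K (u + v) (u' + v')
    & forall a u u', K u u' -> K (a *: u) (a *: u')].

(** U contains a submodule of A-length k: the submodule of the rows whose
    flattening Y B has its rows in the k-dimensional row space of B. *)
Definition row_block k n (U : 'rV[A]_n -> Prop) : Prop :=
  exists (B : 'M[D]_(k, N n)) (C : 'M[D]_(N n, k)),
    B *m C = 1%:M /\ forall Y : 'M_(m, k), U (unflat (Y *m B)).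

Definition col_block l n (V : 'cV[A]_n -> Prop) : Prop :=
  exists (B : 'M[D]_(l, N n)) (C : 'M[D]_(N n, l)),
    B *m C = 1%:M /\ forall Z : 'M_(l, m), V (cunflat (C *m Z)).

(** [relation_rank] through the Morita equivalence: K is determined by the
    linear relation KR between the rows over D of the flattened vectors, because
    left multiplication by A recombines these rows arbitrarily. *)
Lemma linear_rel_rank (divD : division_ring D) n n'
    (K : 'rV[A]_n -> 'rV[A]_n' -> Prop) :
  linear_rel K ->
  exists k l,
    [/\ row_block k (fun u => K u 0),
        col_block l (fun v => forall u u', K u u' -> u *m v = 0),
        l = 0%N -> forall u, exists u', K u u'
      & (n * m <= n' * m + k + l)%N].
Proof.
move=> [K0 KD KZ].
pose KR (r : 'rV_(N n)) (r' : 'rV_(N n')) :=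
  forall y : 'cV[D]_m, K (unflat (y *m r)) (unflat (y *m r')).
have KR_row u u' i : K u u' -> KR (row i (flat u)) (row i (flat u')).
  by move=> Ku y; rewrite !rowE !mulmxA !unflatZ !flatK; apply: KZ.
have [||d r r' Kr y|] := @relation_rank _ divD _ _ KR.
- by move=> y; rewrite !mulmx0 !unflat0.
- by move=> r r' s s' Kr Ks y; rewrite !mulmxDr !unflatD; apply: KD.
- by rewrite -!mul_scalar_mx !mulmxA; apply: Kr.
move=> k [B [C [l [B2 [C2 [BC KB BC2 dom_eq leN]]]]]].
have sum_col_row p q r (Y : 'M[D]_(p, q)) (X : 'M_(q, r)) :
    Y *m X = \sum_i col i Y *m row i X.
  apply/matrixP => i j; rewrite summxE mxE; apply: eq_bigr => h _.
  by rewrite !mxE big_ord1 !mxE.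
exists k, l; split.
- exists B, C; split=> // Y; rewrite sum_col_row.
  elim/big_rec: _ => [|i M _ KM]; first by rewrite unflat0.
  rewrite unflatD -[0]addr0; apply: KD => //.
  by rewrite -(unflat0 n') -(mulmx0 _ (col i Y)); apply: KB.
- exists B2, C2; split=> // Z u u' Ku.
  rewrite -[u]flatK mul_unflat mulmxA.
  suff -> : flat u *m C2 = 0 by rewrite mul0mx rmorph0 raddf0.
  apply/row_matrixP => i; rewrite row_mul row0.
  by apply/dom_eq; exists (row i (flat u')); apply: KR_row.
- move=> l0 u.
  have /choice[r' Kr'] i : exists r', KR (row i (flat u)) r'.
    apply/dom_eq; move: C2 {BC2 B2 leN dom_eq}; rewrite l0 => C2.
    exact: thinmx0.
  exists (\sum_i unflat (delta_mx i (0 : 'I_1) *m r' i)).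
  rewrite -[u in K u]flatK -[flat u]mul1mx sum_col_row.
  elim/big_rec2: _ => [|i u' M _ KM]; first by rewrite unflat0.
  rewrite unflatD; apply: KD => //.
  by rewrite colE mul1mx; apply: Kr'.
- by move: leN; rewrite !card_prod !card_ord.
Qed.

Lemma unflat_eq0 n (M : 'M_(m, N n)) : unflat M = 0 -> M = 0.
Proof. by rewrite -(unflat0 n); apply: (can_inj (@unflatK n)). Qed.

Lemma cunflat_eq0 n (M : 'M_(N n, m)) : cunflat M = 0 -> M = 0.
Proof. by rewrite -(cunflat0 n); apply: (can_inj (@cunflatK n)). Qed.

Lemma psi_eq0 a : psi a = 0 -> a = 0.
Proof. by move=> a0; rewrite -[a]psiK a0 rmorph0. Qed.

(** If m <= k, then the block contains the row pid_mx m B, which generates a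
    free A-module and so is not torsion. *)
Lemma row_block_torsion k n (U : set 'rV[A]_n) :
  left_torsion U -> row_block k U -> (k < m)%N.
Proof.
move=> torU [B [C [BC UB]]]; rewrite ltnNge; apply/negP => le_mk.
have [a /eqP nz_a] := torU _ (UB (pid_mx m)).
rewrite -[a]psiK -unflatZ => /unflat_eq0 aB; apply: nz_a; apply: psi_eq0.
have pidK : (pid_mx m : 'M[D]_(m, k)) *m (pid_mx m : 'M_(k, m)) = 1%:M.
  by rewrite mul_pid_mx minnn (minn_idPr le_mk) pid_mx_1.
have {}aB : psi a *m (pid_mx m : 'M_(m, k)) = 0.
  by rewrite -[LHS]mulmx1 -BC -mulmxA [_ *m (B *m C)]mulmxA mulmxA aB mul0mx.
by rewrite -[LHS]mulmx1 -pidK mulmxA aB mul0mx.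
Qed.

Lemma col_block_torsion l n (V : set 'cV[A]_n) :
  right_torsion V -> col_block l V -> (l < m)%N.
Proof.
move=> torV [B [C [BC VC]]]; rewrite ltnNge; apply/negP => le_ml.
have [a /eqP nz_a] := torV _ (VC (pid_mx m)).
rewrite -[a]psiK -cunflatZ => /cunflat_eq0 Ca; apply: nz_a; apply: psi_eq0.
have pidK : (pid_mx m : 'M[D]_(m, l)) *m (pid_mx m : 'M_(l, m)) = 1%:M.
  by rewrite mul_pid_mx minnn (minn_idPr le_ml) pid_mx_1.
have {}Ca : (pid_mx m : 'M_(l, m)) *m psi a = 0.
  by rewrite -[LHS]mul1mx -BC -mulmxA [C *m _]mulmxA Ca mulmx0.
by rewrite -[LHS]mul1mx -pidK -mulmxA Ca mulmx0.
Qed.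

(** The coordinates Y in the block form the space of all m x k matrices, of
    dimension m k over D, and the d given generators span it. *)
Lemma row_block_dim (divD : division_ring D) k n (U : set 'rV[A]_n) d :
  left_dim phi U d -> row_block k U -> (m * k <= d)%N.
Proof.
move=> [v [_ _ span_v]] [B [C [BC UB]]].
pose T : 'M[D]_(d, m * k) := \matrix_i mxvec (flat (v i) *m C).
(* The rows of T are the coordinates of the generators. *)
have [Z ZT] : exists Z : 'M_(m * k, d), Z *m T = 1%:M.
  have /choice[z zT] (i : 'I_(m * k)) : exists z : 'rV_d, z *m T = row i 1%:M.
    have [c /(congr1 (fun u => mxvec (flat u *m C)))] :=
      span_v _ (UB (vec_mx (row i 1%:M))).
    rewrite unflatK -mulmxA BC mulmx1 vec_mxK => ->.
    exists (\row_j c j); rewrite mulmx_sum_row.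
    have -> : flat (\sum_j phi (c j)%:M *: v j) = \sum_j c j *: flat (v j).
      apply: (can_inj (@unflatK _)); rewrite flatK.
      elim/big_rec2: _ => [|j M u _ ->]; first by rewrite unflat0.
      by rewrite unflatD -(mul_scalar_mx _ (flat _)) unflatZ flatK.
    rewrite mulmx_suml linear_sum; apply: eq_bigr => j _.
    by rewrite rowK !mxE -scalemxAl linearZ.
  exists (\matrix_i z i); apply/row_matrixP => i.
  by rewrite row_mul rowK zT.
exact: (mulmx1_leq divD ZT).
Qed.

Lemma col_block_dim (divD : division_ring D) l n (V : set 'cV[A]_n) d :
  right_dim phi V d -> col_block l V -> (m * l <= d)%N.
Proof.
move=> [v [_ _ span_v]] [B [C [BC VC]]].
pose T : 'M[D]_(l * m, d) := \matrix_(p, i) mxvec (B *m cflat (v i)) 0 p.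
(* Columns over D form a right vector space, hence the transposed shape. *)
have [Z TZ] : exists Z : 'M_(d, l * m), T *m Z = 1%:M.
  have /choice[z Tz] (i : 'I_(l * m)) : exists z : 'cV_d, T *m z = col i 1%:M.
    have [c /(congr1 (fun u => mxvec (B *m cflat u)))] :=
      span_v _ (VC (vec_mx (row i 1%:M))).
    rewrite cunflatK mulmxA BC mul1mx vec_mxK => cE.
    exists (\col_j c j); apply/colP => p.
    have -> : col i 1%:M p 0 = row i (1%:M : 'M[D]_(l * m)) 0 p.
      by rewrite !mxE eq_sym.
    rewrite cE.
    have -> : cflat (\sum_j v j *m (phi (c j)%:M)%:M)
            = \sum_j cflat (v j) *m (c j)%:M.
      apply: (can_inj (@cunflatK _)); rewrite cflatK.
      elim/big_rec2: _ => [|j M u _ ->]; first by rewrite cunflat0.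
      by rewrite cunflatD cunflatZ cflatK.
    rewrite mulmx_sumr linear_sum summxE mxE; apply: eq_bigr => j _.
    rewrite mulmxA !mxE; case/mxvec_indexP: p => i' j'; rewrite !mxvecE.
    rewrite [RHS]mxE (bigD1 j') //= big1 => [|h nhj].
      by rewrite !mxE eqxx mulr1n addr0.
    by rewrite !mxE (negPf nhj) mulr0n mulr0.
  exists (\matrix_(j, i) z i j 0); apply/matrixP => p i.
  have /colP/(_ p) := Tz i; rewrite [RHS]mxE => <-.
  by rewrite !mxE; apply: eq_bigr => j _; rewrite !mxE.
by rewrite mulnC; apply: (mulmx1_leq divD TZ).
Qed.

Lemma row_block_set0 k n : (0 < m)%N ->
  row_block k [set 0 : 'rV[A]_n]%classic -> k = 0%N.
Proof.
move=> m_gt0 [B [C [BC B0]]]; case: k => // k in B C BC B0 *.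
have /unflat_eq0 YB := B0 (delta_mx (Ordinal m_gt0) 0).
have : delta_mx (Ordinal m_gt0) 0 = 0 :> 'M[D]_(m, k.+1).
  by rewrite -[LHS]mulmx1 -BC mulmxA YB mul0mx.
by move/matrixP/(_ (Ordinal m_gt0) 0)/eqP; rewrite !mxE !eqxx oner_eq0.
Qed.

Lemma col_block_set0 l n : (0 < m)%N ->
  col_block l [set 0 : 'cV[A]_n]%classic -> l = 0%N.
Proof.
move=> m_gt0 [B [C [BC C0]]]; case: l => // l in B C BC C0 *.
have /cunflat_eq0 CZ := C0 (delta_mx 0 (Ordinal m_gt0)).
have : delta_mx 0 (Ordinal m_gt0) = 0 :> 'M[D]_(l.+1, m).
  by rewrite -[LHS]mul1mx -BC -mulmxA CZ mulmx0.
by move/matrixP/(_ 0 (Ordinal m_gt0))/eqP; rewrite !mxE !eqxx oner_eq0.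
Qed.

End Morita.

(** * Replacing an initial letter by elements of A *)

Section FirstLetter.

Variables (F : fieldType) (A : algType F) (g : nat).
Local Notation AX := (gpoly A g).

Definition eval_at (y : A) : {lrmorphism AX -> A} :=
  gp_eval (idfun : {lrmorphism A -> A}) (fun _ : 'I_g => y).

Lemma scale_cst (k : F) (p : AX) : k *: p = gp_cst g k%:A * p.
Proof. by []. Qed.

Section FoxDerivative.

Variables (x : 'I_g) (y : A).

Local Notation const_term :=
  (geval (idfun : {lrmorphism A -> A}) (fun _ : 'I_g => 0)).

(** The map A<x> -> A<x> sending a x p to a y p, and a and a z p to 0 for the
    letters z other than x.  It satisfies the Fox rule
    d (p q) = p_0 d q + d p q, where p_0 is the constant term of p; this rule
    defines it on formal expressions. *)
Fixpoint fox_term (t : gterm A g) : AX :=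
  match t with
  | TCst a => 0
  | TVar z => if z == x then gp_cst g y else 0
  | TAdd s u => fox_term s + fox_term u
  | TMul s u => gp_cst g (const_term s) * fox_term u + fox_term s * gpi u
  end.

Lemma fox_term_congr s t : gcongr s t -> fox_term s = fox_term t.
Proof.
have gpD (s' t' : gterm A g) : gpi (TAdd s' t') = gpi s' + gpi t'.
  by rewrite /GRing.add /= gp_addE.
have gpM (s' t' : gterm A g) : gpi (TMul s' t') = gpi s' * gpi t'.
  by rewrite /GRing.mul /= gp_mulE.
elim=> {s t} //=.
- by move=> s t u _ -> _ ->.
- by move=> s s' t t' _ -> _ ->.
- move=> s s' t t' eqs -> eqt ->.
  by have /gpiE-> := eqt; rewrite (geval_congr _ _ eqs).
- by move=> s t u; rewrite addrA.
- by move=> s t; rewrite addrC.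
- by move=> s; rewrite add0r.
- by move=> s; rewrite mul0r addr0 rmorphN rmorph1 mulN1r addNr.
- by move=> s t u; rewrite gpM rmorphM mulrDr mulrDl !mulrA addrA.
- by move=> s; rewrite mul0r addr0 rmorph1 mul1r.
- by move=> s; rewrite mulr0 add0r -[gpi _]/(1 : AX) mulr1.
- by move=> s t u; rewrite rmorphD !mulrDl addrACA.
- by move=> s t u; rewrite gpD !mulrDr addrACA.
- by move=> *; rewrite addr0.
- by move=> *; rewrite mulr0 mul0r addr0.
- move=> k s; rewrite mul0r addr0 mulr0 add0r -[gpi _]/(gp_cst g k%:A).
  by rewrite gp_cst_central.
Qed.

Definition fox (p : AX) : AX := fox_term (repr p).

Lemma foxE t : fox (gpi t) = fox_term t.
Proof. by apply: fox_term_congr; apply/gpiE; rewrite gpi_repr. Qed.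

Fact fox_is_zmod_morphism : zmod_morphism fox.
Proof.
have foxD p q : fox (p + q) = fox p + fox q.
  elim/gpi_ind: p => s; elim/gpi_ind: q => t.
  by rewrite {1}/GRing.add /= gp_addE !foxE.
by move=> p q; apply: (addIr (fox q)); rewrite -foxD !subrK.
Qed.

HB.instance Definition _ :=
  GRing.isZmodMorphism.Build AX AX fox fox_is_zmod_morphism.

Lemma fox_cstM a p : fox (gp_cst g a * p) = gp_cst g a * fox p.
Proof.
elim/gpi_ind: p => t; rewrite {1}/GRing.mul /= gp_mulE !foxE /=.
by rewrite mul0r addr0.
Qed.

Lemma fox_varM p : fox (gp_var A x * p) = gp_cst g y * p.
Proof.
elim/gpi_ind: p => t; rewrite {1}/GRing.mul /= gp_mulE !foxE /= eqxx.
by rewrite rmorph0 mul0r add0r.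
Qed.

End FoxDerivative.

(** A nonzero sub-bimodule J of A^n contains a nonzero row with entries in F.
    In an element u of J of minimal support, one entry can be turned into 1 by
    simplicity of A without enlarging the support; the commutators with the
    elements of A then have smaller support, so they vanish and all the entries
    are central. *)
Lemma bimodule_scalar_row (simpleA : simple_ring A) (centerA : center_is_base A)
    n (J : 'rV[A]_n -> Prop) :
  (forall u v, J u -> J v -> J (u + v)) ->
  (forall b u, J u -> J (b *: u)) -> (forall b u, J u -> J (u *m b%:M)) ->
  forall u, J u -> u != 0 ->
  exists2 l : 'rV[F]_n, l != 0 & J (\row_k (l 0 k)%:A).
Proof.
move=> JD JZ JM u; have [N] := ubnP #|[set k | u 0 k != 0]|.
elim: N u => // N IHN u leN Ju nz_u.
have [k0 nz_k0] : exists k, u 0 k != 0.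
  apply: contrapT => u0; case/eqP: nz_u; apply/rowP => k; rewrite mxE.
  by apply: contrapT => /eqP uk; apply: u0; exists k.
have J0 : J 0 by rewrite -(scale0r u); apply: JZ.
pose supp_in (v : 'rV[A]_n) := forall k, u 0 k = 0 -> v 0 k = 0.
(* I is the ideal of the values at k0 of the elements of J supported in u. *)
pose I : set A := [set y | exists v, [/\ J v, supp_in v & v 0 k0 = y]]%classic.
have ID y z : I y -> I z -> I (y + z).
  move=> [v [Jv sv <-]] [w [Jw sw <-]]; exists (v + w); split=> [|k uk|].
  - exact: JD.
  - by rewrite mxE sv // sw // addr0.
  - by rewrite mxE.
have rightE (v : 'rV[A]_n) b k : (v *m b%:M) 0 k = v 0 k * b.
  rewrite mxE (bigD1 k) //= big1 => [|h nhk].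
    by rewrite !mxE eqxx mulr1n addr0.
  by rewrite !mxE (negPf nhk) mulr0n mulr0.
have I0 : I 0 by exists 0; split=> // [k _|]; rewrite mxE.
have [||I_triv|I_all] := simpleA I.
- split=> // b y [v [Jv sv <-]]; exists (b *: v); split=> [|k uk|].
  + exact: JZ.
  + by rewrite mxE sv // mulr0.
  + by rewrite mxE.
- split=> // b y [v [Jv sv <-]]; exists (v *m b%:M); split=> [|k uk|].
  + exact: JM.
  + by rewrite rightE sv // mul0r.
  + by rewrite rightE.
- have : I (u 0 k0) by exists u; split=> // k.
  by rewrite I_triv => /= /eqP; rewrite (negPf nz_k0).
have [v [Jv sv vk0]] : I 1 by rewrite I_all.
have [central|ncentral] := pselect (forall k b, v 0 k * b = b * v 0 k).
  have /choice[l vl] k : exists l : F, v 0 k = l%:A by apply/centerA/central.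
  exists (\row_k l k); last first.
    rewrite [X in J X](_ : _ = v) //.
    by apply/rowP => k; rewrite !mxE vl.
  apply/eqP => /rowP/(_ k0); rewrite !mxE => l0.
  by move/eqP: vk0; rewrite vl l0 scale0r eq_sym oner_eq0.
have [k1 [b nz_b]] : exists k b, v 0 k * b <> b * v 0 k.
  by move: ncentral => /existsNP[k /existsNP[b ?]]; exists k, b.
(* The entry at k0 is 1, hence commutes with b and disappears from w. *)
pose w := v *m b%:M + (- b) *: v.
have wE k : w 0 k = v 0 k * b - b * v 0 k.
  by rewrite mxE rightE mxE mulNr.
apply: (IHN w).
- apply: leq_trans _ (ltnSE leN); apply/proper_card/properP; split.
    apply/fintype.subsetP => k; rewrite !inE wE; apply: contra_neq => uk.
    by rewrite sv // mul0r mulr0 subr0.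
  by exists k0; rewrite !inE // wE vk0 mul1r mulr1 subrr eqxx.
- by apply: JD; [apply: JM|apply: JZ].
- apply/eqP => /rowP/(_ k1); rewrite wE mxE => /eqP.
  by rewrite subr_eq0 => /eqP.
Qed.

(** An identity that holds for all y in A is a formal consequence of F-linear
    relations between the p_k, so y may be replaced by any q in A<x>.  The rows
    a satisfying the hypothesis form a sub-bimodule of A^n, so for a <> 0 there
    is a nonzero one with entries in F; at y = 1 it expresses some p_k through
    the others, which shortens the identity. *)
Lemma generic_identity (simpleA : simple_ring A) (centerA : center_is_base A)
    n (a : 'rV[A]_n) (p : 'I_n -> AX) :
  (forall y, \sum_k gp_cst g (a 0 k) * (gp_cst g y * p k) = 0) ->
  forall q, \sum_k gp_cst g (a 0 k) * (q * p k) = 0.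
Proof.
elim: n a p => [|n IHn] a p ap0 q; first by rewrite big_ord0.
pose J (u : 'rV[A]_n.+1) :=
  forall y, \sum_k gp_cst g (u 0 k) * (gp_cst g y * p k) = 0.
have [->|nz_a] := eqVneq a 0.
  by rewrite big1 // => k _; rewrite mxE rmorph0 mul0r.
have [|||||l nz_l Jl] := @bimodule_scalar_row simpleA centerA _ J _ _ _ a.
- move=> u v Ju Jv y.
  have := congr2 +%R (Ju y) (Jv y); rewrite addr0 => sum0; rewrite -[RHS]sum0.
  by rewrite -big_split; apply: eq_bigr => k _; rewrite mxE rmorphD mulrDl.
- move=> b u Ju y; rewrite -[RHS](mulr0 (gp_cst g b)) -[X in _ = _ * X](Ju y).
  rewrite mulr_sumr.
  by apply: eq_bigr => k _; rewrite mxE rmorphM -[LHS]mulrA.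
- move=> b u Ju y; rewrite -[RHS](Ju (b * y)); apply: eq_bigr => k _.
  rewrite mxE (bigD1 k) //= big1 => [|h nhk].
    by rewrite !mxE eqxx mulr1n addr0 !rmorphM !mulrA.
  by rewrite !mxE (negPf nhk) mulr0n mulr0.
- by [].
- by [].
have [k0 nz_k0] : exists k, l 0 k != 0.
  apply: contrapT => l0; case/eqP: nz_l; apply/rowP => k; rewrite mxE.
  by apply: contrapT => /eqP lk; apply: l0; exists k.
pose mu j := - (l 0 (lift k0 j) / l 0 k0).
have pk0 : p k0 = \sum_j mu j *: p (lift k0 j).
  have := Jl 1; under eq_bigr => k _ do rewrite rmorph1 mul1r mxE
    -[gp_cst g _ * _]/(l 0 k *: p k).
  rewrite (bigD1_ord k0) //= => /eqP; rewrite addr_eq0 => /eqP.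
  move/(congr1 (fun z => (l 0 k0)^-1 *: z)).
  rewrite scalerA mulVf // scale1r => ->; rewrite -sumrN scaler_sumr.
  apply: eq_bigr => j _; rewrite -scaleNr scalerA /mu; congr (_ *: _).
  by rewrite mulrN mulrC.
pose a' := \row_j (a 0 (lift k0 j) + mu j *: a 0 k0).
have reduce r : \sum_k gp_cst g (a 0 k) * (r * p k)
              = \sum_j gp_cst g (a' 0 j) * (r * p (lift k0 j)).
  rewrite (bigD1_ord k0) //= pk0 !mulr_sumr -big_split /=.
  apply: eq_bigr => j _; rewrite mxE rmorphD mulrDl addrC; congr (_ + _).
  by rewrite -!scalerAr /= linearZ /= -scalerAl.
by rewrite reduce IHn // => y; rewrite -reduce.
Qed.

(** Membership in the subspace A x A<x>. *)
Definition starts_with (x : 'I_g) (z : AX) : Prop :=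
  exists s : seq (A * AX),
    z = \sum_(t <- s) gp_cst g t.1 * (gp_var A x * t.2).

(** The map fox x y turns a sum of a_k x p_k into the sum of a_k y p_k, so this
    is [generic_identity] at q = x. *)
Lemma starts_with_eq0 (simpleA : simple_ring A) (centerA : center_is_base A)
    x z :
  starts_with x z -> (forall y, fox x y z = 0) -> z = 0.
Proof.
move=> [s ->] dz; rewrite big_tnth.
pose a := \row_k (tnth (in_tuple s) k).1.
transitivity
  (\sum_k gp_cst g (a 0 k) * (gp_var A x * (tnth (in_tuple s) k).2)).
  by apply: eq_bigr => k _; rewrite mxE.
apply: (generic_identity simpleA centerA
          (p := fun k => (tnth (in_tuple s) k).2)) => y.
rewrite -[RHS](dz y) raddf_sum [RHS]big_tnth; apply: eq_bigr => k _ /=.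
by rewrite mxE fox_cstM fox_varM.
Qed.

Lemma starts_with_sum x (I : Type) (r : seq I) (P : pred I) (z : I -> AX) :
  (forall i, starts_with x (z i)) -> starts_with x (\sum_(i <- r | P i) z i).
Proof.
move=> sz; elim/big_rec: _ => [|i p _ [s ->]].
  by exists [::]; rewrite big_nil.
by have [t ->] := sz i; exists (t ++ s); rewrite big_cat.
Qed.

Lemma starts_with_cstM x a z :
  starts_with x z -> starts_with x (gp_cst g a * z).
Proof.
move=> [s ->]; exists [seq (a * t.1, t.2) | t <- s]; rewrite big_map mulr_sumr.
by apply: eq_bigr => t _; rewrite rmorphM !mulrA.
Qed.

Lemma homog_starts_with x q p : homog [:: x] q -> starts_with x (q * p).
Proof.
move=> [s ->]; rewrite mulr_suml; apply: starts_with_sum => t /=.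
exists [:: ((t.1)%:A * t.2 0%N, gp_cst g (t.2 1%N) * p)].
by rewrite big_seq1 /= scale_cst rmorphM !mulrA.
Qed.

Lemma fox_homog x y q p :
  homog [:: x] q -> fox x y (q * p) = gp_cst g (eval_at y q) * p.
Proof.
move=> [s ->]; rewrite mulr_suml raddf_sum rmorph_sum rmorph_sum mulr_suml.
apply: eq_bigr => t _ /=; rewrite -scalerAl.
rewrite scale_cst fox_cstM -!mulrA fox_cstM fox_varM.
rewrite [eval_at y _]linearZ /= -[in RHS]mulr_algl !rmorphM /= gp_eval_var.
by rewrite !gp_eval_cst !mulrA.
Qed.

End FirstLetter.

(** * Comparison of two representations *)

Section Representations.

Variables (F : fieldType) (A : algType F) (g : nat).
Hypotheses (simpleA : simple_ring A) (centerA : center_is_base A).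
Local Notation AX := (gpoly A g).
Local Notation cst := (map_mx (gp_cst g)).

Definition linear_mx x p q (M : 'M[AX]_(p, q)) : Prop :=
  forall i j, homog [:: x] (M i j).

Definition subst_mx (y : A) p q (M : 'M[AX]_(p, q)) : 'M[A]_(p, q) :=
  map_mx (eval_at g y) M.

Lemma starts_with_mulmx x p q r s (U : 'M[A]_(p, q)) (M : 'M_(q, r))
    (P : 'M_(r, s)) i j :
  linear_mx x M -> starts_with x ((cst U *m M *m P) i j).
Proof.
move=> linM; rewrite -mulmxA mxE; apply: starts_with_sum => k.
rewrite !mxE; apply: starts_with_cstM; apply: starts_with_sum => l.
exact: homog_starts_with.
Qed.

Lemma fox_mulmx x y p q r s (U : 'M[A]_(p, q)) (M : 'M_(q, r))
    (P : 'M_(r, s)) :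
  linear_mx x M ->
  map_mx (fox x y) (cst U *m M *m P) = cst (U *m subst_mx y M) *m P.
Proof.
move=> linM; rewrite map_mxM -!mulmxA; apply/matrixP => i j.
rewrite !mxE raddf_sum; apply: eq_bigr => k _.
rewrite !mxE /= fox_cstM raddf_sum; congr (_ * _); apply: eq_bigr => l _.
by rewrite !mxE /= fox_homog.
Qed.

(** A matrix identity in A x A<x> may be checked after substituting elements of
    A for the initial letter x. *)
Lemma starts_with_mx_eq x p q (M N : 'M[AX]_(p, q)) :
  (forall i j, starts_with x (M i j)) -> (forall i j, starts_with x (N i j)) ->
  (forall y, map_mx (fox x y) M = map_mx (fox x y) N) -> M = N.
Proof.
move=> xM xN eqd; apply/matrixP => i j; apply/eqP; rewrite -subr_eq0.
apply/eqP/(starts_with_eq0 simpleA centerA (x := x)) => [|y].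
  have [[s ->] [t ->]] := (xM i j, xN i j).
  exists (s ++ [seq (- e.1, e.2) | e <- t]).
  rewrite big_cat big_map -sumrN; congr (_ + _).
  by apply: eq_bigr => e _; rewrite rmorphN mulNr.
by have /matrixP/(_ i j) := eqd y; rewrite !mxE raddfB /= => ->; rewrite subrr.
Qed.

Section Pair.

Variables (n1 n2 : nat) (r1 : repr_data A g n1) (r2 : repr_data A g n2).

Lemma word_mx_cons n (r : repr_data A g n) x w :
  word_mx r (x :: w) = rA r x *m word_mx r w.
Proof. by rewrite /word_mx big_cons. Qed.

Lemma word_mx_nil n (r : repr_data A g n) : word_mx r [::] = 1%:M.
Proof. by rewrite /word_mx big_nil. Qed.

Definition same_output (u : 'rV[A]_n1) (v : 'rV[A]_n2) : Prop :=
  forall w,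
    cst u *m word_mx r1 w *m cst (rb r1) = cst v *m word_mx r2 w *m cst (rb r2).

Lemma same_output_repr S :
  represents r1 S -> represents r2 S -> same_output (rc r1) (rc r2).
Proof. by move=> r1S r2S w; rewrite r1S r2S. Qed.

Lemma same_output_linear : linear_rel same_output.
Proof.
split=> [w|u u' v v' Ku Kv w|a u u' Ku w]; first by rewrite !raddf0 !mul0mx.
  by rewrite !raddfD !mulmxDl Ku Kv.
have mapZ n (t : 'rV[A]_n) : cst (a *: t) = gp_cst g a *: cst t.
  by apply/matrixP => i j; rewrite !mxE rmorphM.
by rewrite !mapZ -!scalemxAl Ku.
Qed.

(** Apply fox x y to the equality of outputs for the word x w. *)
Lemma same_output_subst x y u v :
  same_output u v ->
  same_output (u *m subst_mx y (rA r1 x)) (v *m subst_mx y (rA r2 x)).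
Proof.
move=> Kuv w; have := congr1 (map_mx (fox x y)) (Kuv (x :: w)).
by rewrite !word_mx_cons !mulmxA -!(mulmxA (_ *m rA _ x)) !fox_mulmx ?mulmxA;
  try exact: rA_lin.
Qed.

(** By induction on w, u A1^w v = 0 for every u in the domain of the relation,
    in particular for u = c1: the initial letter of x w may be replaced by any
    y in A, and u A1^x(y) is again in the domain. *)
Lemma annihilator_right_obstruction S (v : 'cV[A]_n1) :
  represents r1 S -> represents r2 S ->
  (forall u u', same_output u u' -> u *m v = 0) -> right_obstruction r1 v.
Proof.
move=> r1S r2S Kv w.
have := same_output_repr r1S r2S.
elim: w (rc r1) (rc r2) => [|x w IHw] u u' Ku.
  by rewrite word_mx_nil mulmx1 -map_mxM (Kv _ _ Ku) raddf0.
rewrite word_mx_cons mulmxA -mulmxA.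
apply: (@starts_with_mx_eq x) => [i j|i j|y].
- by apply: starts_with_mulmx; apply: rA_lin.
- by exists [::]; rewrite big_nil mxE.
- rewrite fox_mulmx; last exact: rA_lin.
  rewrite mulmxA (IHw _ _ (same_output_subst x y Ku)).
  by apply/matrixP => i j; rewrite !mxE raddf0.
Qed.

Lemma same_output_inj u u' v : left_obstruction r1 = [set 0]%classic ->
  same_output u v -> same_output u' v -> u = u'.
Proof.
move=> obs0 Kuv Ku'v; apply/eqP; rewrite -subr_eq0.
suff: left_obstruction r1 (u - u') by rewrite obs0 => /= ->.
by move=> w; rewrite raddfB !mulmxBl Kuv Ku'v subrr.
Qed.

End Pair.

Lemma same_output_sym n1 n2 (r1 : repr_data A g n1) (r2 : repr_data A g n2)
    u v :
  same_output r1 r2 u v -> same_output r2 r1 v u.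
Proof. by move=> Kuv w; rewrite Kuv. Qed.

Lemma transition_same_output n (r1 r2 : repr_data A g n) (P Q : 'M[A]_n) u :
  Q *m P = 1%:M ->
  (forall x, rA r2 x = cst P *m rA r1 x *m cst Q) -> rb r2 = P *m rb r1 ->
  same_output r1 r2 u (u *m Q).
Proof.
move=> QP eqA eqb w.
have cQP : cst Q *m cst P = 1%:M by rewrite -map_mxM QP map_mx1.
rewrite eqb !map_mxM !mulmxA; congr (_ *m _); rewrite -!mulmxA; congr (_ *m _).
elim: w => [|x w IHw]; first by rewrite !word_mx_nil mul1mx.
by rewrite !word_mx_cons eqA {1}IHw !mulmxA cQP mul1mx -!mulmxA.
Qed.

Lemma same_output_mulmx n1 n2 (r1 : repr_data A g n1) (r2 : repr_data A g n2)
    p (M : 'M[A]_(p, n1)) (N : 'M[A]_(p, n2)) u :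
  (forall i, same_output r1 r2 (row i M) (row i N)) ->
  same_output r1 r2 (u *m M) (u *m N).
Proof.
move=> KMN; have [K0 KD KZ] := same_output_linear r1 r2.
rewrite !mulmx_sum_row; elim/big_rec2: _ => // i v v' _ Kv.
by apply: KD => //; apply: KZ.
Qed.

(** If the relation is the graph of u |-> u Q, with inverse v |-> v P, the
    identities defining a transition matrix are read off from uniqueness of
    related rows: the pair (c1, c2), the stability under substitution and the
    output of the empty word give those for c, A and b respectively. *)
Lemma same_output_transition n (r1 r2 : repr_data A g n) (P Q : 'M[A]_n) :
  left_obstruction r1 = [set 0]%classic ->
  left_obstruction r2 = [set 0]%classic ->
  same_output r1 r2 (rc r1) (rc r2) ->
  (forall u, same_output r1 r2 u (u *m Q)) ->
  (forall v, same_output r1 r2 (v *m P) v) ->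
  transition r1 r2 P.
Proof.
move=> obs1 obs2 Kc KQ KP.
have injR u v v' : same_output r1 r2 u v -> same_output r1 r2 u v' -> v = v'.
  by move=> /same_output_sym Kv /same_output_sym; apply: same_output_inj Kv.
have PQ : P *m Q = 1%:M.
  apply/row_matrixP => i; rewrite row_mul !rowE mulmx1.
  exact: injR (KQ _) (KP _).
have QP : Q *m P = 1%:M.
  apply/row_matrixP => i; rewrite row_mul !rowE mulmx1.
  exact: same_output_inj obs1 (KP _) (KQ _).
exists Q; split=> // [|x|].
- exact: injR Kc (KQ _).
- apply: (@starts_with_mx_eq x) => [i j|i j|y].
  + have -> : rA r2 x = cst 1%:M *m rA r2 x *m 1%:M.
      by rewrite mulmx1 map_mx1 mul1mx.
    by apply: starts_with_mulmx; apply: rA_lin.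
  + by apply: starts_with_mulmx; apply: rA_lin.
  have {1}-> : rA r2 x = cst 1%:M *m rA r2 x *m 1%:M.
    by rewrite mulmx1 map_mx1 mul1mx.
  rewrite !fox_mulmx; try exact: rA_lin.
  rewrite mulmx1 mul1mx -map_mxM; congr (cst _).
  apply/row_matrixP => i; rewrite !rowE -{1}[delta_mx _ _]mulmx1 -PQ !mulmxA.
  apply: injR (same_output_subst x y (KQ (delta_mx 0 i *m P))) _.
  exact: KQ.
- have cst_inj q r : injective (fun M : 'M[A]_(q, r) => cst M).
    move=> M N /matrixP eqMN; apply/matrixP => i j; have := eqMN i j.
    rewrite !mxE => /(congr1 (gp_eval idfun (fun=> 0))).
    by rewrite !gp_eval_cst.
  apply/row_matrixP => i; rewrite !rowE mulmxA; apply: cst_inj.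
  by have := KP (delta_mx 0 i) [::]; rewrite !word_mx_nil !mulmx1 !map_mxM.
Qed.

End Representations.

(** The domain of [same_output] has length at most n2 m + k, and its
    annihilator, of length l, consists of right obstructions.  The lengths k and
    l are lower bounds for those of the obstruction modules, so they inherit
    their upper bounds. *)
Lemma obstruction_rank (F : fieldType) (A : algType F) g (D : unitRingType) m
    (phi : {rmorphism 'M[D]_m -> A}) (psi : A -> 'M[D]_m) :
  simple_ring A -> center_is_base A -> division_ring D ->
  cancel psi phi ->
  forall (S : gseries A g) n1 n2
    (r1 : repr_data A g n1) (r2 : repr_data A g n2),
  represents r1 S -> represents r2 S ->
  exists k l,
    [/\ row_block phi k (left_obstruction r1),
        col_block phi l (right_obstruction r1),
        l = 0%N -> forall u, exists v, same_output r1 r2 u v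
      & (n1 * m <= n2 * m + k + l)%N].
Proof.
move=> simpleA centerA divD psiK S n1 n2 r1 r2 r1S r2S.
have [k [l [[B [C [BC KB]]] [B2 [C2 [BC2 KC2]]] onto len]]] :=
  linear_rel_rank psiK divD (same_output_linear r1 r2).
exists k, l; split=> //.
- exists B, C; split=> // Y w; rewrite (KB Y w).
  by rewrite raddf0 !mul0mx.
- exists B2, C2; split=> // Z.
  exact: (annihilator_right_obstruction simpleA centerA r1S r2S (KC2 Z)).
Qed.

Theorem theorem4p13 (F : fieldType) (A : algType F) (D : unitRingType) (m : nat)
    (phi : {rmorphism 'M[D]_m -> A}) (g : nat) (S : gseries A g)
    (charF : [pchar F] =i pred0)
    (simpleA : simple_ring A) (artinA : artinian_ring A)
    (centerA : center_is_base A)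
    (divD : division_ring D) (phi_bij : bijective phi)
    (recS : recognizable S) :
  [/\ forall n1 n2 (r1 : repr_data A g n1) (r2 : repr_data A g n2),
        represents r1 S -> represents r2 S -> reduced r1 -> reduced r2 ->
        (n1 <= n2 + 1)%N /\ (n2 <= n1 + 1)%N,
      forall n (r : repr_data A g n) (dL dR : nat),
        represents r S ->
        left_dim phi (left_obstruction r) dL ->
        right_dim phi (right_obstruction r) dR ->
        (dL + dR < m ^ 2)%N ->
        minimal r S
    & forall n1 n2 (r1 : repr_data A g n1) (r2 : repr_data A g n2),
        represents r1 S -> represents r2 S ->
        totally_reduced r1 -> totally_reduced r2 ->
        exists e : n1 = n2,
          exists! P : 'M[A]_n2, transition (cast_repr e r1) r2 P].
Proof.
have [psi phiK psiK] := phi_bij.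
have m_gt0 : (0 < m)%N.
  rewrite lt0n; apply/eqP => m0; have : 1 = 0 :> A.
    rewrite -(rmorph1 phi) -(rmorph0 phi); congr (phi _).
    by apply/matrixP => -[i lti]; exfalso; move: lti; rewrite m0.
  by apply/eqP; rewrite oner_eq0.
have rank := @obstruction_rank _ _ g _ _ _ _ simpleA centerA divD psiK S.
have leq_div (p q c : nat) :
    (p * m <= q * m + c -> c < (2 * m) -> p <= q + 1)%N.
  move=> le_pq lt_c; rewrite -ltnS -addnS -(ltn_pmul2r m_gt0) mulnDl.
  by apply: leq_ltn_trans le_pq _; rewrite ltn_add2l.
have reduced_leq n1 n2 (r1 : repr_data A g n1) (r2 : repr_data A g n2) :
    represents r1 S -> represents r2 S -> reduced r1 -> (n1 <= n2 + 1)%N.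
  move=> r1S r2S [torL torR].
  have [k [l [kL lR _ len]]] := rank _ _ _ _ r1S r2S.
  apply: (leq_div _ _ (k + l)%N); first by rewrite addnA.
  have := row_block_torsion phiK psiK torL kL.
  have := col_block_torsion phiK psiK torR lR.
  by move=> ltl /ltnW lek; rewrite mul2n -addnn -addnS leq_add.
split.
- by move=> n1 n2 r1 r2 r1S r2S red1 red2; split; apply: reduced_leq.
- move=> n r dL dR rS dimL dimR lt_d; split=> // n' r' r'S.
  have [k [l [kL lR _ len]]] := rank _ _ _ _ rS r'S.
  have := leq_add (row_block_dim phiK psiK divD dimL kL)
                  (col_block_dim phiK psiK divD dimR lR).
  move=> /leq_ltn_trans/(_ lt_d); rewrite -mulnDr -mulnn ltn_pmul2l // => ltkl.
  rewrite -ltnS -(ltn_pmul2r m_gt0) mulSn addnC.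
  by apply: leq_ltn_trans len _; rewrite -addnA ltn_add2l.
move=> n1 n2 r1 r2 r1S r2S red1 red2.
have total_leq p q (s : repr_data A g p) (t : repr_data A g q) :
    represents s S -> represents t S -> totally_reduced s ->
    (p <= q)%N /\ forall u, exists v, same_output s t u v.
  move=> sS tS [sL sR]; have [k [l [kL lR onto len]]] := rank _ _ _ _ sS tS.
  move: kL lR; rewrite sL sR => /(row_block_set0 phiK m_gt0) k0.
  move=> /(col_block_set0 phiK m_gt0) l0; split; last exact: onto.
  by move: len; rewrite k0 l0 !addn0 leq_pmul2r.
have [le12 onto12] := total_leq _ _ _ _ r1S r2S red1.
have [le21 onto21] := total_leq _ _ _ _ r2S r1S red2.
have e : n1 = n2 by apply/eqP; rewrite eqn_leq le12.
exists e; case: _ / e r2 r2S red2 onto12 onto21 {le12 le21}.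
move=> r2 r2S red2 onto12 onto21.
rewrite /cast_repr /=.
have [[obs1 _] [obs2 _]] := (red1, red2).
have Kc := same_output_repr r1S r2S.
have [q Kq] := choice onto12; have [p Kp] := choice onto21.
pose Q := \matrix_i q (row i 1%:M); pose P := \matrix_i p (row i 1%:M).
have KQ u : same_output r1 r2 u (u *m Q).
  by rewrite -{1}[u]mulmx1; apply: same_output_mulmx => i; rewrite rowK.
have KP v : same_output r1 r2 (v *m P) v.
  rewrite -{2}[v]mulmx1; apply: same_output_mulmx => i; rewrite rowK.
  exact: same_output_sym.
exists P; split.
  exact: (same_output_transition simpleA centerA obs1 obs2 Kc KQ KP).
move=> P' [Q' [PQ' QP' _ eqA eqb]].
have QP : Q' *m P = 1%:M.
  apply/row_matrixP => i; rewrite row_mul !rowE mulmx1.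
  exact: (same_output_inj obs1 (KP _) (transition_same_output _ QP' eqA eqb)).
by rewrite -[P]mul1mx -PQ' -mulmxA QP mulmx1.
Qed.
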